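(* Let $r\ge 2$ and $m,n\ge 1$ be integers, and let $\mathbf{k}_1,\dots,\mathbf{k}_n$ be independent samples from the Conway-Maxwell-Multivariate (COMM) distribution with common $m$ and parameters $(\mathbf{p},\nu)$, where $k_{ij}$ denotes the $i$-th component of the $j$-th sample ($1\le i\le r$, $1\le j\le n$). Then the following statistics are jointly sufficient for $(\mathbf{p},\nu)$: $$S_0=\sum_{j=1}^n\log[k_{1j}!\,k_{2j}!\cdots k_{rj}!],\qquad S_i=\sum_{j=1}^n k_{ij},\quad i=1,\dots,r-1 .$$
   Context: Let $D$ be the set of integer vectors $\mathbf{j}=(j_1,\dots,j_r)$ with $j_i\ge 0$ and $\sum_{i=1}^r j_i=m$. For $\mathbf{k}\in D$ write $\binom{m}{\mathbf{k}}=\frac{m!}{k_1!k_2!\cdots k_r!}$. For $\mathbf{p}=(p_1,\dots,p_r)$ with $p_i\ge 0$, $\sum_{i=1}^r p_i=1$, and $\nu\in\mathbb{R}$, the COMM distribution (with fixed $m$) is the distribution on $D$ with probability mass function $$P\{\mathbf{X}=\mathbf{k}\mid\mathbf{p},\nu\}=\binom{m}{\mathbf{k}}^\nu\prod_{i=1}^r p_i^{k_i}\Big/\sum_{\mathbf{j}\in D}\binom{m}{\mathbf{j}}^\nu\prod_{i=1}^r p_i^{j_i},\qquad \mathbf{k}\in D,$$ with the convention $0^0=1$. *)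

(* Defs.v *)
From HB Require Import structures.
From mathcomp Require Import all_boot all_order all_algebra.
From mathcomp Require Import all_classical all_reals all_analysis.

Set Implicit Arguments.
Unset Strict Implicit.
Unset Printing Implicit Defensive.

Import Order.TTheory GRing.Theory Num.Theory.

Local Open Scope classical_set_scope.
Local Open Scope ring_scope.

(* A nonnegative integer vector of sum m has all its components at most m, so
   bounding them by m only serves to make the type finite. *)
Definition comm_support (r m : nat) : Type :=
  {k : {ffun 'I_r -> 'I_m.+1} | (\sum_i k i)%N == m}.

HB.instance Definition _ (r m : nat) := SubFinite.on (comm_support r m).

Definition component (r m : nat) (k : comm_support r m) (i : 'I_r) : nat := val k i.

Record comm_param (R : realType) (r : nat) := CommParam {
  cp_p : 'I_r -> R;
  cp_nu : R;
  cp_p_ge0 : forall i, 0 <= cp_p i;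
  cp_p_sum1 : \sum_i cp_p i = 1
}.

Definition multinomial_coef (R : realType) (r m : nat)
    (k : comm_support r m) : R :=
  m`!%:R / \prod_(i < r) (component k i)`!%:R.

Definition comm_weight (R : realType) (r m : nat) (theta : comm_param R r)
    (k : comm_support r m) : R :=
  multinomial_coef R k `^ cp_nu theta
  * \prod_(i < r) cp_p theta i ^+ component k i.

Definition comm_pmf (R : realType) (r m : nat) (theta : comm_param R r)
    (k : comm_support r m) : R :=
  comm_weight theta k / \sum_(j : comm_support r m) comm_weight theta j.

(* Random element of a countable set S, every subset of S being an event. *)
Definition discrete_rv (d : measure_display) (Omega : measurableType d)
    (S : countType) (X : Omega -> S) : Prop :=
  forall B : set S, measurable (X @^-1` B).

Definition has_pmf (d : measure_display) (Omega : measurableType d)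
    (R : realType) (P : probability Omega R) (S : countType) (X : Omega -> S)
    (f : S -> R) : Prop :=
  forall x : S, P [set w | X w = x] = (f x)%:E.

Definition mutually_independent (d : measure_display)
    (Omega : measurableType d) (R : realType) (P : probability Omega R)
    (I : finType) (S : countType) (X : I -> Omega -> S) : Prop :=
  forall (J : {set I}) (B : I -> set S),
    P (\bigcap_(j in [set` J]) (X j @^-1` B j))
    = (\prod_(j in J) P (X j @^-1` B j))%E.

Definition cond_prob (d : measure_display) (Omega : measurableType d)
    (R : realType) (P : probability Omega R) (A B : set Omega) : R :=
  fine (P (A `&` B)) / fine (P B).

(* For discrete data X, the statistic T is sufficient for the family of laws
   (P theta) when the conditional distribution of X given T(X) = t can be
   chosen independently of theta; conditional probabilities given an event of
   probability zero are left unconstrained. *)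
Definition sufficient (Theta : Type) (d : measure_display)
    (Omega : measurableType d) (R : realType)
    (P : Theta -> probability Omega R) (S : countType) (X : Omega -> S)
    (V : Type) (T : S -> V) : Prop :=
  exists q : V -> S -> R, forall (theta : Theta) (t : V) (x : S),
    P theta [set w | T (X w) = t] <> 0%E ->
    cond_prob (P theta) [set w | X w = x] [set w | T (X w) = t] = q t x.

Definition sample (Omega : Type) (r m n : nat)
    (X : 'I_n -> Omega -> comm_support r m) (w : Omega) :
    {ffun 'I_n -> comm_support r m} :=
  [ffun j => X j w].

Definition stat_S0 (R : realType) (r m n : nat)
    (k : {ffun 'I_n -> comm_support r m}) : R :=
  \sum_(j < n) ln (\prod_(i < r) (component (k j) i)`!)%N%:R.

Definition stat_S (r m n : nat) (k : {ffun 'I_n -> comm_support r m})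
    (i : 'I_r) : nat :=
  (\sum_(j < n) component (k j) i)%N.

(* 'I_r.-1 is embedded in 'I_r as its first r - 1 elements: the last component
   is omitted. *)
Definition comm_stat (R : realType) (r m n : nat)
    (k : {ffun 'I_n -> comm_support r m}) : R * {ffun 'I_r.-1 -> nat} :=
  (stat_S0 R k, [ffun i => stat_S k (widen_ord (leq_pred r) i)]).

(* Main.v *)
(* The joint probability of a sample depends on the sample only through the
   statistic, with no further factor: the missing count S_r is recovered from
   S_1 + ... + S_r = n m, and the multinomial coefficients contribute
   exp (nu (n ln m! - S_0)). Hence, whatever the parameter, the conditional law
   given the statistic is uniform on the fibre of the statistic. *)

Require Import Defs.
From HB Require Import structures.
From mathcomp Require Import all_boot all_order all_algebra finmap.
From mathcomp Require Import all_classical all_reals all_analysis.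

Import Order.TTheory GRing.Theory Num.Theory.

Local Open Scope classical_set_scope.
Local Open Scope ring_scope.

(** Since [S] is finite, the event [T (X w) = t] is a finite disjoint union of the events [X w = y]
    over the fibre. These are equiprobable, so conditioning leaves the inverse of the size of the
    fibre. *)
Lemma sufficient_of_law_constant_on_fibres (Theta : Type) (d : measure_display)
    (Omega : measurableType d) (R : realType)
    (P : Theta -> probability Omega R) (S : finType) (X : Omega -> S)
    (V : Type) (T : S -> V) :
  (forall x, measurable [set w | X w = x]) ->
  (forall theta x y, T x = T y ->
     P theta [set w | X w = x] = P theta [set w | X w = y]) ->
  sufficient P X T.
Proof.
move=> mX PT.
(* Off the fibre the value is 0, because [X w = x] then excludes [T (X w) = t]. *)
exists (fun t x => if `[< T x = t >]
    then #|` fset_set [set y | T y = t]|%:R^-1 else 0) => theta t x.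
have fin_fibre : finite_set [set y | T y = t] by exact: finite_finset.
have PTt : P theta [set w | T (X w) = t] =
    (\sum_(y <- fset_set [set y | T y = t]) P theta [set w | X w = y])%E.
  rewrite -fsbig_finite//.
  rewrite -(measure_fin_bigcup (P theta) fin_fibre)//; last first.
    by move=> y z _ _ [w [/= <- <-]].
  congr (P theta _); apply/seteqP; split=> [w /= <-|w [y /= <- <-]//].
  by exists (X w).
rewrite PTt /cond_prob PTt; case: asboolP => [Txt|Txt] Pt_neq0; last first.
  rewrite (_ : _ `&` _ = set0) ?measure0 ?mul0r// -subset0 => w [/= ->].
  by [].
rewrite (_ : _ `&` _ = [set w | X w = x]); last first.
  by apply/seteqP; split=> [w []//|w /= wx]; split=> //=; rewrite wx.
move: Pt_neq0; rewrite (eq_big_seq (fun=> P theta [set w | X w = x])); last first.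
  by move=> y; rewrite in_fset_set// inE/= => Tyt; apply: PT; rewrite Tyt.
have Pfin : P theta [set w | X w = x] \is a fin_num by exact: fin_num_measure.
rewrite -(fineK Pfin) sumEFin/= big_const_seq count_predT iter_addr_0.
move: (fine _) => p.
(* If the common probability [p] vanished, so would that of the conditioning event. *)
have [->|p0 _] := eqVneq p 0; first by rewrite mul0rn.
by rewrite -[in X in _ / X]mulr_natr invfM mulrA divff// mul1r.
Qed.

(** Exchanging the products over samples and components collects the exponents of each
    [cp_p theta i] into [stat_S k i]. *)
Lemma prod_comm_pmf (R : realType) (r m n : nat) (theta : comm_param R r)
    (k : {ffun 'I_n -> comm_support r m}) :
  \prod_(j < n) comm_pmf theta (k j) =
  expR (cp_nu theta * (ln m`!%:R *+ n - stat_S0 R k)) *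
  \prod_(i < r) cp_p theta i ^+ stat_S k i
  / (\sum_(j : comm_support r m) comm_weight theta j) ^+ n.
Proof.
rewrite /comm_pmf /comm_weight big_split/= prodfV prodr_const card_ord.
rewrite big_split/=; congr (_ * _ / _); last first.
  by rewrite exchange_big/=; apply: eq_bigr => i _; rewrite -expr_sum.
have fact_gt0R p : 0 < p`!%:R :> R by rewrite ltr0n fact_gt0.
transitivity (\prod_(j < n) expR (cp_nu theta * (ln (m`!%:R : R) -
    ln (\prod_(i < r) (component (k j) i)`!)%N%:R))).
  apply: eq_bigr => j _; rewrite /multinomial_coef -natr_prod.
  have prod0 : 0 < (\prod_(i < r) (component (k j) i)`!)%N%:R :> R.
    by rewrite ltr0n prodn_gt0// => i; rewrite fact_gt0.
  (* The coefficient is positive, so [powR] is the exponential of [cp_nu theta] times its logarithm,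
     not the default value at 0. *)
  by rewrite /powR gt_eqF ?divr_gt0// ln_div ?posrE.
rewrite -expR_sum; congr expR.
by rewrite -mulr_sumr sumrB sumr_const card_ord.
Qed.

Lemma sum_stat_S (r m n : nat) (k : {ffun 'I_n -> comm_support r m}) :
  (\sum_(i < r) stat_S k i = n * m)%N.
Proof.
rewrite /stat_S exchange_big/= -[in RHS](card_ord n) -sum_nat_const.
by apply: eq_bigr => j _; apply/eqP/(valP (k j)).
Qed.

(** [comm_stat] fixes every count but the last, and the common total [n * m] then fixes the last
    one. *)
Lemma stat_S_eq (R : realType) (r m n : nat)
    (k l : {ffun 'I_n -> comm_support r m}) :
  comm_stat R k = comm_stat R l -> stat_S k =1 stat_S l.
Proof.
case: r k l => [|r] k l [_ /ffunP kl]; first by case.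
have eqw (i : 'I_r) : stat_S k (widen_ord (leqnSn r) i)
    = stat_S l (widen_ord (leqnSn r) i).
  (* The two embeddings differ only in their proofs of the same inequality. *)
  by have := kl i; rewrite !ffunE (bool_irrelevance (leq_pred _) (leqnSn r)).
have := sum_stat_S _ _ _ k; rewrite -(sum_stat_S _ _ _ l) !big_ord_recr/=.
under eq_bigr do rewrite eqw.
move=> /addnI eqmax i.
case: (unliftP ord_max i) => [j|] -> //.
rewrite (_ : lift _ _ = widen_ord (leqnSn r) j) ?eqw//.
exact/val_inj/lift_max.
Qed.

(** This puts the event in the form required by [mutually_independent], with all indices and
    singleton targets. *)
Lemma sample_eventE (Omega : Type) (r m n : nat)
    (X : 'I_n -> Omega -> comm_support r m)
    (k : {ffun 'I_n -> comm_support r m}) :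
  [set w | sample X w = k] =
  \bigcap_(j in [set` [set: 'I_n]%SET]) (X j @^-1` [set k j]).
Proof.
apply/seteqP; split=> [w /= <- j _|w /= Xk]; first by rewrite /= ffunE.
by apply/ffunP => j; rewrite ffunE; apply: Xk; rewrite /= inE.
Qed.

Theorem proposition5 (R : realType) (r m n : nat)
    (hr : (2 <= r)%N) (hm : (1 <= m)%N) (hn : (1 <= n)%N)
    (d : measure_display) (Omega : measurableType d)
    (P : comm_param R r -> probability Omega R)
    (X : 'I_n -> Omega -> comm_support r m)
    (X_rv : forall j : 'I_n, discrete_rv (X j))
    (X_indep : forall theta : comm_param R r,
       mutually_independent (P theta) X)
    (X_comm : forall (theta : comm_param R r) (j : 'I_n),
       has_pmf (P theta) (X j) (comm_pmf theta)) :
  sufficient P (sample X) (@comm_stat R r m n).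
Proof.
apply: sufficient_of_law_constant_on_fibres => [k|theta k l kl].
  rewrite sample_eventE; apply: fin_bigcap_measurable => // j _.
  exact: X_rv.
have P_sample (h : {ffun 'I_n -> comm_support r m}) :
    P theta [set w | sample X w = h] = (\prod_(j < n) comm_pmf theta (h j))%:E.
  rewrite sample_eventE (X_indep theta _ (fun j => [set h j])) -prodEFin.
  by apply: eq_big => [j|j _]; [rewrite inE|exact: X_comm].
(* The first component of [kl] matches the exponential factors; [stat_S_eq] matches the powers,
   including that of the omitted component. *)
rewrite !P_sample !prod_comm_pmf; case: (kl) => -> _.
by under eq_bigr do rewrite (stat_S_eq _ _ _ _ _ _ kl).
Qed.
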